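(* Let $F$ be a field, let $R$ be an equivalence relation on a finite set $U=\{x_1,\dots,x_n\}$, and let $B(R)$ be the matrix representation of $R$, regarded as a matrix over $F$ with columns labeled by $x_1,\dots,x_n$. Then $M(R)=M_F[B(R)]$ (equality of matroids on the ground set $U$).
   Context: Let $U/R=\{P_1,\dots,P_s\}$ be the set of equivalence classes of $R$. $\mathcal{C}(R)$ denotes the family of all two-element subsets $\{x,y\}\subseteq U$ ($x\neq y$) such that $\{x,y\}\subseteq P_i$ for some $i\in\{1,\dots,s\}$. $M(R)$ denotes the unique matroid on $U$ whose set of circuits is $\mathcal{C}(R)$ (it is known that such a matroid exists). The matrix representation of $R$ is $B(R)=(b_{ij})_{s\times n}$ with $b_{ij}=1$ if $x_j\in P_i$ and $b_{ij}=0$ if $x_j\notin P_i$, where $1$ and $0$ are the multiplicative and additive identities of $F$; its $j$-th column is labeled by $x_j$. For an $m\times n$ matrix $A$ over $F$ with columns labeled by the elements of $U$, the vector matroid $M_F[A]$ is the matroid on $U$ in which $X\subseteq U$ is independent iff the family of columns of $A$ labeled by $X$ is linearly independent in $F^m$. *)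

(* Defs.v *)
From HB Require Import structures.
From mathcomp Require Import all_boot all_order all_algebra.

Set Implicit Arguments.
Unset Strict Implicit.
Unset Printing Implicit Defensive.

Import GRing.Theory.

(* The ground set of a matroid is the whole finite type [U]. *)
Definition is_matroid (U : finType) (I : {set {set U}}) : bool :=
  [&& set0 \in I,
      [forall X : {set U}, forall Y : {set U},
         (Y \in I) ==> (X \subset Y) ==> (X \in I)]
    & [forall X : {set U}, forall Y : {set U},
         (X \in I) ==> (Y \in I) ==> (#|X| < #|Y|) ==>
         [exists y, (y \in Y :\: X) && (y |: X \in I)]]].

Record matroid (U : finType) := Matroid {
  indep : {set {set U}};
  indep_axiom : is_matroid indep }.

HB.instance Definition _ (U : finType) := [isSub for @indep U].
HB.instance Definition _ (U : finType) := [Choice of matroid U by <:].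

Lemma is_matroidP (U : finType) (I : {set {set U}}) :
  reflect [/\ set0 \in I,
              forall X Y : {set U}, Y \in I -> X \subset Y -> X \in I
            & forall X Y : {set U}, X \in I -> Y \in I -> #|X| < #|Y| ->
                exists2 y, y \in Y :\: X & y |: X \in I]
          (is_matroid I).
Proof.
apply: (iffP and3P) => [[h0 h1 h2] | [h0 h1 h2]]; split=> //.
- move=> X Y YI XY; move/forallP/(_ X)/forallP/(_ Y): h1.
  by rewrite YI XY.
- move=> X Y XI YI XY; move/forallP/(_ X)/forallP/(_ Y): h2.
  by rewrite XI YI XY => /existsP[y /andP[]]; exists y.
- apply/forallP=> X; apply/forallP=> Y.
  by apply/implyP=> YI; apply/implyP; apply: h1 YI.
- apply/forallP=> X; apply/forallP=> Y.
  apply/implyP=> XI; apply/implyP=> YI; apply/implyP=> XY.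
  by have [y yY yI] := h2 X Y XI YI XY; apply/existsP; exists y; rewrite yY.
Qed.

Definition circuits (U : finType) (M : matroid U) : {set {set U}} :=
  [set C | minset [pred D | D \notin indep M] C].

Lemma indep_circuits (U : finType) (M : matroid U) (X : {set U}) :
  (X \in indep M) = [forall C in circuits M, ~~ (C \subset X)].
Proof.
have [_ sub _] := is_matroidP _ (indep_axiom M).
apply/idP/forall_inP=> [XI C | noC].
  rewrite inE => /minsetP[/= CD _]; apply: contra CD; exact: sub.
apply/negPn/negP=> /(@minset_exists _ [pred D | D \notin indep M] X).
by case=> C Cmin; apply/negP/noC; rewrite inE.
Qed.

Lemma circuits_inj (U : finType) : injective (@circuits U).
Proof.
move=> M1 M2 eqC; apply: val_inj; apply/setP=> X.
by rewrite /= !indep_circuits eqC.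
Qed.

Definition eqrel_circuits (U : finType) (R : rel U) : {set {set U}} :=
  [set C : {set U} | (#|C| == 2) &&
     [exists P in equivalence_partition R [set: U], C \subset P]].

Lemma eqrel_matroid_subproof (U : finType) (R : rel U) :
  equivalence_rel R -> exists M : matroid U, circuits M == eqrel_circuits R.
Proof.
move=> hR.
have Rxx x : R x x by have [] := hR x x x.
have Rl x y z : R x y -> R x z = R y z by have [_] := hR x y z.
pose I := [set X : {set U} | [forall C in eqrel_circuits R, ~~ (C \subset X)]].
have inI (X : {set U}) : reflect {in X &, forall y z, R y z -> y = z} (X \in I).
  rewrite inE; apply: (iffP forall_inP) => [noC y z yX zX Ryz | inj C].
    apply/eqP/negPn/negP=> yz.
    suff /noC/negP[] : [set y; z] \in eqrel_circuits R.
      by apply/subsetP=> u /set2P[] ->.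
    rewrite inE cards2 yz /=; apply/exists_inP.
    exists [set u in [set: U] | R y u]; first exact: imset_f.
    by apply/subsetP=> u /set2P[] ->; rewrite !inE ?Rxx ?Ryz.
  rewrite inE => /andP[/cards2P[y [z [yz ->]]]].
  case/exists_inP=> _ /imsetP[w _ ->] /subsetP yzP.
  have /[!inE]/= Rwy := yzP _ (set21 y z).
  have /[!inE]/= Rwz := yzP _ (set22 y z).
  apply/negP=> /subsetP yzX; case/eqP: yz; apply: inj.
  - exact/yzX/set21.
  - exact/yzX/set22.
  - by rewrite -(Rl _ _ _ Rwy).
have I_matroid : is_matroid I.
  apply/is_matroidP; split.
  - by apply/inI=> y z; rewrite inE.
  - move=> X Y /inI YI /subsetP XY; apply/inI=> y z /XY yY /XY zY.
    exact: YI.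
  - move=> X Y /inI XI /inI YI ltXY.
    pose cl x := [set z | R x z].
    have clP x y : (cl x == cl y) = R x y.
      apply/eqP/idP=> [/setP/(_ y)|Rxy]; first by rewrite !inE Rxx.
      by apply/setP=> z; rewrite !inE (Rl _ _ _ Rxy).
    have cardcl (Z : {set U}) : {in Z &, forall y z, R y z -> y = z} ->
        #|cl @: Z| = #|Z|.
      move=> ZI; apply: card_in_imset => y z yZ zZ /eqP.
      by rewrite clP; apply: ZI.
    have /subsetPn[_ /imsetP[y yY ->] yX] : ~~ (cl @: Y \subset cl @: X).
      apply: contraL ltXY => /subset_leq_card.
      by rewrite !cardcl // -leqNgt.
    have nyX z : z \in X -> R z y = false.
      move=> zX; apply: contraNF yX; rewrite -clP => /eqP <-.
      exact: imset_f.
    exists y.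
      by rewrite inE yY andbT; apply/negP=> /nyX; rewrite Rxx.
    apply/inI=> u v /setU1P[->|uX] /setU1P[->|vX] //.
    + by move=> Ryv; move: (nyX _ vX); rewrite -(Rl _ _ _ Ryv) Rxx.
    + by rewrite nyX.
    + exact: XI.
exists (Matroid I_matroid); apply/eqP/setP=> C; rewrite inE /=.
have indepN D : (D \notin I) = [exists C in eqrel_circuits R, C \subset D].
  rewrite inE negb_forall_in; apply: eq_existsb => C'.
  by rewrite negbK.
apply/minsetP/idP=> /= [[] | CR].
  rewrite indepN => /exists_inP[D DR DC] minC.
  rewrite -(minC D) // indepN.
  by apply/exists_inP; exists D.
split; first by rewrite indepN; apply/exists_inP; exists C.
move=> D; rewrite indepN => /exists_inP[C' C'R C'D] DC.
have [cC cC'] : #|C| = 2 /\ #|C'| = 2.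
  by move: CR C'R; rewrite !inE => /andP[/eqP-> _] /andP[/eqP-> _].
apply/eqP; rewrite eqEcard DC cC -cC'.
exact: subset_leq_card.
Qed.

(* The matroid whose set of circuits is [eqrel_circuits R]; it is unique by
   [circuits_inj]. *)
Definition eqrel_matroid (U : finType) (R : rel U) (hR : equivalence_rel R) :
  matroid U := xchoose (eqrel_matroid_subproof hR).

Lemma circuits_eqrel_matroid (U : finType) (R : rel U)
  (hR : equivalence_rel R) : circuits (eqrel_matroid hR) = eqrel_circuits R.
Proof. exact/eqP/(xchooseP (eqrel_matroid_subproof hR)). Qed.

Definition eqrel_mx (F : fieldType) (U : finType) (n s : nat)
  (x : 'I_n -> U) (P : 'I_s -> {set U}) : 'M[F]_(s, n) :=
  \matrix_(i < s, j < n) (if x j \in P i then 1 else 0)%R.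

(* The [j]-th column of [A] is labeled by [x j]. The columns labeled by [X] are
   kept as a sequence, so that equal columns with distinct labels count as a
   linearly dependent family. *)
Definition columns (F : fieldType) (U : finType) (m n : nat)
  (A : 'M[F]_(m, n)) (x : 'I_n -> U) (X : {set U}) : seq 'cV[F]_m :=
  [seq col j A | j <- enum (x @^-1: X)].

Definition vector_indep (F : fieldType) (U : finType) (m n : nat)
  (A : 'M[F]_(m, n)) (x : 'I_n -> U) : {set {set U}} :=
  [set X | free (columns A x X)].

Lemma vector_matroid_subproof (F : fieldType) (U : finType) (m n : nat)
  (A : 'M[F]_(m, n)) (x : 'I_n -> U) (hx : bijective x) :
  is_matroid (vector_indep A x).
Proof.
have [g xg gx] := hx.
have size_cols X : size (columns A x X) = #|X|.
  rewrite size_map -cardE on_card_preimset //.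
  by exists g => ? _; [apply: xg | apply: gx].
apply/is_matroidP; split.
- by rewrite inE /columns preimset0 enum_set0 /= nil_free.
- move=> X Y; rewrite !inE => fY /subsetP XY.
  have p : perm_eq (columns A x Y) (columns A x X ++ columns A x (Y :\: X)).
    rewrite -map_cat perm_map //; apply: uniq_perm.
    + exact: enum_uniq.
    + rewrite cat_uniq !enum_uniq andbT /=; apply/hasPn=> j.
      by rewrite !mem_enum !inE => /andP[].
    + move=> j; rewrite mem_cat !mem_enum !inE.
      by case: (boolP (x j \in X)) => // /XY ->.
  by move: fY; rewrite (perm_free p); apply: catl_free.
- move=> X Y; rewrite !inE => fX fY ltXY.
  have pU y : y \notin X ->
      perm_eq (columns A x (y |: X)) (col (g y) A :: columns A x X).
    move=> yX; rewrite -[_ :: _]/(map (fun j => col j A) (g y :: _)) perm_map //.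
    apply: uniq_perm; first exact: enum_uniq.
      by rewrite /= enum_uniq mem_enum inE gx yX.
    by move=> j; rewrite inE !mem_enum !inE -(can_eq gx) xg.
  have [/existsP[y /andP[yYX fy]] | /existsPn noy] :=
      boolP [exists y, (y \in Y :\: X) && free (columns A x (y |: X))].
    by exists y; rewrite // inE.
  suff /dimvS : (<<columns A x Y>> <= <<columns A x X>>)%VS.
    move: fY fX; rewrite /free !size_cols => /eqP-> /eqP->.
    by rewrite leqNgt ltXY.
  apply/span_subvP=> _ /mapP[j + ->]; rewrite mem_enum inE => jY.
  have [jX | jX] := boolP (x j \in X).
    by apply/memv_span/map_f; rewrite mem_enum inE.
  move: (noy (x j)); rewrite inE jX jY (perm_free (pU _ jX)) free_cons fX andbT.
  by rewrite xg /= andbT negbK.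
Qed.

Definition vector_matroid (F : fieldType) (U : finType) (m n : nat)
  (A : 'M[F]_(m, n)) (x : 'I_n -> U) (hx : bijective x) : matroid U :=
  Matroid (vector_matroid_subproof A hx).

(* Main.v *)
(* Two elements of [U] label equal columns of [B(R)] iff they are equivalent,
   and each column is a standard basis vector. A family of standard basis
   vectors is free iff it has no repetition, so the independent sets of the
   vector matroid are the sets meeting each class at most once, which are the
   sets containing no pair of [eqrel_circuits R]. *)
Require Import Defs.
From mathcomp Require Import all_boot all_order all_algebra.

Set Implicit Arguments.
Unset Strict Implicit.
Unset Printing Implicit Defensive.

(** By induction on [t]: every combination of basis vectors with indices other than [i] has [i]-th
    coordinate 0, so a new head [delta_mx i 0] lies in the span of the tail only if [i] already
    occurs there. *)
Lemma free_delta_mx (F : fieldType) (m : nat) (t : seq 'I_m) :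
  free [seq delta_mx i 0%R : 'cV[F]_m | i <- t] = uniq t.
Proof.
elim: t => [|i t IHt]; first by rewrite nil_free.
rewrite /= free_cons IHt; congr (~~ _ && _).
apply/idP/idP=> [i_span | it]; last exact/memv_span/map_f.
apply/negPn/negP=> it.
have /eqP := congr1 (fun v : 'cV[F]_m => v i ord0)
                    (coord_span (X := in_tuple _) i_span).
rewrite mxE !eqxx summxE big1 ?GRing.oner_eq0 // => k _.
have := mem_nth 0%R (ltn_ord k); case/mapP=> l lt ->.
rewrite !mxE; case: eqP => [il | _]; last by rewrite GRing.mulr0.
by rewrite il lt in it.
Qed.

(** A circuit is exactly a pair of distinct equivalent elements, so a set contains no circuit iff
    [R] is equality on it. *)
Lemma eqrel_indepP (U : finType) (R : rel U) (hR : equivalence_rel R)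
    (X : {set U}) :
  reflect {in X &, forall y z, R y z -> y = z} (X \in indep (eqrel_matroid hR)).
Proof.
have Rxx y : R y y by have [] := hR y y y.
rewrite indep_circuits circuits_eqrel_matroid.
apply: (iffP forall_inP) => [noC y z yX zX Ryz | inj C].
  apply/eqP/negPn/negP=> yz.
  suff /noC/negP[] : [set y; z] \in eqrel_circuits R.
    by apply/subsetP=> u /set2P[] ->.
  rewrite inE cards2 yz; apply/exists_inP.
  exists [set u in [set: U] | R y u]; first exact: imset_f.
  by apply/subsetP=> u /set2P[] ->; rewrite !inE ?Rxx ?Ryz.
rewrite inE => /andP[/cards2P[y [z [yz ->]]]].
case/exists_inP=> _ /imsetP[w _ ->]; rewrite !subUset !sub1set !inE /=.
case/andP=> Rwy Rwz; apply: contra yz => /andP[yX zX].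
by apply/eqP/inj => //; have [_ <-] := hR w y z.
Qed.

Theorem theorem1 (F : fieldType) (U : finType) (n : nat) (x : 'I_n -> U)
  (hx : bijective x) (R : rel U) (hR : equivalence_rel R)
  (s : nat) (P : 'I_s -> {set U}) (hPinj : injective P)
  (hP : [set P i | i : 'I_s] = equivalence_partition R [set: U]) :
  eqrel_matroid hR = vector_matroid (eqrel_mx F x P) hx.
Proof.
have Rxx y : R y y by have [] := hR y y y.
have Rl y z w : R y z -> R y w = R z w by have [_] := hR y z w.
pose cl y := [set z in [set: U] | R y z].
have clP y z : (cl y == cl z) = R y z.
  apply/eqP/idP => [/setP/(_ z) | Ryz]; first by rewrite !inE Rxx.
  by apply/setP=> w; rewrite !inE (Rl _ _ _ Ryz).
(* [c j] is the index of the class of [x j], hence the row of the only 1 in column [j]. *)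
have /fin_all_exists[c Pc] (j : 'I_n) : exists i, P i = cl (x j).
  have : cl (x j) \in [set P i | i : 'I_s] by rewrite hP imset_f.
  by case/imsetP=> i _ ->; exists i.
have cP j k : (c j == c k) = R (x j) (x k).
  by rewrite -(inj_eq hPinj) !Pc clP.
have colE j : col j (eqrel_mx F x P) = delta_mx (c j) 0%R.
  apply/matrixP=> i k; rewrite !mxE (ord1 k) andbT.
  have /imsetP[y _ Pi] : P i \in equivalence_partition R [set: U].
    by rewrite -hP imset_f.
  rewrite -(inj_eq hPinj) Pc Pi -/(cl y) clP !inE /=.
  by case: (R y (x j)).
apply: val_inj; apply/setP=> X; rewrite [RHS]inE.
have -> : columns (eqrel_mx F x P) x X =
    [seq delta_mx i 0%R | i <- [seq c j | j <- enum (x @^-1: X)]].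
  by rewrite -map_comp; apply: eq_map.
(* Absence of repetitions among the [c j] is by definition injectivity of [c] on [x @^-1: X]; it
   remains to transport this along the bijection [x]. *)
rewrite free_delta_mx -/(dinjectiveb c _).
have [g xg gx] := hx.
apply/eqrel_indepP/dinjectiveP => [inj j k | inj y z yX zX Ryz].
  rewrite !inE => jX kX /eqP; rewrite cP => Rjk.
  by apply: (can_inj xg); apply: inj.
by apply: (can_inj gx); apply: inj; rewrite ?inE ?gx //; apply/eqP; rewrite cP !gx.
Qed.
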